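(* Let $H$ be a metric space and $K\subset H$ a compact subspace such that every $y\in H\setminus K$ projects to $K$. Then for every $\ell\ge 0$ there is a homeomorphism $$\mathcal{M}^\ell(H)\approx\mathring{\mathcal{M}}^\ell(H)\vee\mathcal{M}^\ell(K).$$
   Context: A point $y\in H$ projects to $K\subset H$ if there exists $\pi(y)\in K$ with $d(k,y)=d(k,\pi(y))+d(\pi(y),y)$ for every $k\in K$. Write $\mathrm{int}(H)=H\setminus K$; $K$ carries the induced metric. For points $x_0,\dots,x_n$ of a metric space write $d(x_0,\dots,x_n)=\sum_{i=1}^n d(x_{i-1},x_i)$. The causal order on $X\times\mathbb{R}$ is $(x,t)\le(x',t')$ iff $d(x,x')\le t'-t$. $\mathrm{Cau}^\ell(X;a,b)=\{(x,t)\in X\times[0,\ell]\mid d(a,x)\le t,\ d(x,b)\le\ell-t\}$, and $\mathrm{Cau}^\ell(X)=\bigsqcup_{a,b\in X}\mathrm{Cau}^\ell(X;a,b)$ (disjoint union of posets). $\Delta P$ is the order complex of a poset $P$ (simplices are finite nonempty chains). $\Delta'\mathrm{Cau}^\ell(X)$ is the subcomplex of $\Delta\mathrm{Cau}^\ell(X)$ of chains $(x_0,t_0)<\dots<(x_n,t_n)$ with $d(x_0,\dots,x_n)<\ell$. The total magnitude homotopy type is the pointed CW complex $\mathcal{M}^\ell(X)=|\Delta\mathrm{Cau}^\ell(X)|/|\Delta'\mathrm{Cau}^\ell(X)|$ (with $Y/\emptyset=Y\sqcup\{*\}$, $\emptyset/\emptyset=\{*\}$). $S'(H)$ is the set of simplices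 $((x_0,t_0),\dots,(x_n,t_n))\in\Delta\mathrm{Cau}^\ell(H)$ such that $x_k\in\mathrm{int}(H)$ for some $0\le k\le n$. The union $S'(H)\cup\Delta'\mathrm{Cau}^\ell(H)$ is a subcomplex of $\Delta\mathrm{Cau}^\ell(H)$, and $$\mathring{\mathcal{M}}^\ell(H)=\frac{|S'(H)\cup\Delta'\mathrm{Cau}^\ell(H)|}{|\Delta'\mathrm{Cau}^\ell(H)|}.$$ *)

(* Defs.v *)
From HB Require Import structures.
From mathcomp Require Import all_boot all_order all_algebra.
From mathcomp Require Import finmap.
From mathcomp Require Import all_classical all_reals all_analysis.
From mathcomp Require Import wedge_sigT.

Set Implicit Arguments.
Unset Strict Implicit.
Unset Printing Implicit Defensive.

Import Order.TTheory GRing.Theory Num.Theory.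
Local Open Scope classical_set_scope.
Local Open Scope ring_scope.

Definition pointed_homeomorphic (X Y : ptopologicalType) : Prop :=
  exists (f : X -> Y) (g : Y -> X),
    [/\ cancel f g, cancel g f, continuous f, continuous g & f point = point].

Definition wedge_sum (X Y : ptopologicalType) : ptopologicalType :=
  pwedge (fun b : bool => if b then X else Y).

(** The pointed quotient [X / A]: its points are those of [X] outside [A]
    together with a base point [None], the image of [A]. A set is open when its
    preimage in [X] is, so that [X / set0] is [X] with an isolated base point
    added, and [set0 / set0] is a single point. *)
Section quotient_by.
Variables (X : topologicalType) (A : set X).

Definition quotient_by : Type := option (~` A).

Definition collapse (x : X) : quotient_by := insub x.

Definition quotient_by_open (U : set quotient_by) : Prop :=
  open (collapse @^-1` U).

Lemma quotient_by_openT : quotient_by_open setT.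
Proof. by rewrite /quotient_by_open preimage_setT; exact: openT. Qed.

Lemma quotient_by_openI : setI_closed quotient_by_open.
Proof. by move=> U V oU oV; exact: openI. Qed.

Lemma quotient_by_open_bigU (I : Type) (U : I -> set quotient_by) :
  (forall i, quotient_by_open (U i)) -> quotient_by_open (\bigcup_i U i).
Proof. by move=> oU; apply: bigcup_open => i _; exact: oU. Qed.

HB.instance Definition _ := Choice.copy quotient_by (option (~` A)).
HB.instance Definition _ := isOpenTopological.Build quotient_by
  quotient_by_openT quotient_by_openI quotient_by_open_bigU.
HB.instance Definition _ := isPointed.Build quotient_by None.

End quotient_by.

(** Points are given by their barycentric coordinates. For a family [F] closed
    under nonempty subsets this is the geometric realization of the simplicial
    complex [F]; the closure is not built in because for the union
    [interior_simplices K `|` short_complex] used below it holds only when the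
    points outside [K] project to [K]. *)
Section realization.
Variables (R : realType) (V : choiceType).

Definition realization (F : set {fset V}) : Type :=
  [set f : {fsfun V -> R with 0} |
    [/\ F (finsupp f), forall v, 0 <= f v & \sum_(v <- finsupp f) f v = 1]].

Definition coords (F : set {fset V}) (x : realization F) :
  {fsfun V -> R with 0} := val x.

(** The weak topology: a set is open when its trace on every closed simplex is
    open for the Euclidean topology of that simplex. *)
Definition realization_open (F : set {fset V}) (U : set (realization F)) : Prop :=
  forall s, F s -> forall x, (finsupp (coords x) `<=` s)%fset -> U x ->
  exists2 e : R, 0 < e &
    forall y, (finsupp (coords y) `<=` s)%fset ->
      (forall v, v \in s -> `|coords x v - coords y v| < e) -> U y.

Lemma realization_openT (F : set {fset V}) : realization_open (@setT (realization F)).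
Proof. by move=> s _ x _ _; exists 1. Qed.

Lemma realization_openI (F : set {fset V}) : setI_closed (@realization_open F).
Proof.
move=> U W oU oW s Fs x xs [Ux Wx].
have [e e0 eU] := oU s Fs x xs Ux; have [e' e'0 eW] := oW s Fs x xs Wx.
exists (Num.min e e'); first by rewrite lt_min e0.
move=> y ys xy; split; [apply: eU => // v vs|apply: eW => // v vs];
  by have := xy v vs; rewrite lt_min => /andP[].
Qed.

Lemma realization_open_bigU (F : set {fset V}) (I : Type)
    (U : I -> set (realization F)) :
  (forall i, realization_open (U i)) -> realization_open (\bigcup_i U i).
Proof.
move=> oU s Fs x xs [i _ Ux]; have [e e0 eU] := oU i s Fs x xs Ux.
by exists e => // y ys xy; exists i => //; exact: eU.
Qed.

HB.instance Definition _ (F : set {fset V}) := gen_eqMixin (realization F).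
HB.instance Definition _ (F : set {fset V}) := gen_choiceMixin (realization F).
HB.instance Definition _ (F : set {fset V}) :=
  isOpenTopological.Build (realization F)
    (@realization_openT F) (@realization_openI F) (@realization_open_bigU F).

(** [|F| / |G|], for a subcomplex [G] of [F]. *)
Definition realization_quotient (F G : set {fset V}) : ptopologicalType :=
  quotient_by [set x : realization F | G (finsupp (coords x))].

End realization.

Definition order_complex d (P : porderType d) : set {fset P} :=
  [set s | s != fset0 /\ {in s &, forall p q : P, (p >=< q)%O}].

Section induced_metric.
Variables (R : realType) (X : metricType R) (K : set X).

Definition induced_dist (x y : K) : R := mdist (val x) (val y).

Lemma induced_dist_ge0 (x y : K) : 0 <= induced_dist x y.
Proof. exact: mdist_ge0. Qed.

Lemma induced_dist_positivity (x y : K) : induced_dist x y = 0 -> x = y.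
Proof. by move=> /mdist_positivity; exact: val_inj. Qed.

Lemma ball_induced_dist (x : K) (e : R) :
  ball x e = [set y | induced_dist x y < e].
Proof.
transitivity ((val : K -> X) @^-1` ball (val x) e) => //.
by rewrite ballEmdist.
Qed.

HB.instance Definition _ := PseudoMetric_isMetric.Build R K
  induced_dist_ge0 induced_dist_positivity ball_induced_dist.

End induced_metric.

Definition projects_to (R : realType) (X : metricType R) (K : set X) (y : X) :
    Prop :=
  exists2 p : X, K p & forall k, K k -> mdist k y = mdist k p + mdist p y.

Section event.
Variables (R : realType) (X : metricType R).

Definition event : Type := (X * R)%type.

HB.instance Definition _ := Choice.copy event (X * R)%type.

Definition causal_le (p q : event) : bool := mdist p.1 q.1 <= q.2 - p.2.

Lemma causal_le_refl : reflexive causal_le.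
Proof. by move=> p; rewrite /causal_le mdistxx subrr. Qed.

Lemma causal_le_anti : antisymmetric causal_le.
Proof.
move=> [x t] [y s] /andP[]; rewrite /causal_le /= => xy yx.
have st : t <= s by rewrite -subr_ge0; exact: le_trans (mdist_ge0 _ _) xy.
have ts : s <= t by rewrite -subr_ge0; exact: le_trans (mdist_ge0 _ _) yx.
have {st ts} ts : t = s by apply/eqP; rewrite eq_le st ts.
rewrite ts subrr in xy *; congr (_, _); apply: mdist_positivity.
by apply/eqP; rewrite eq_le xy mdist_ge0.
Qed.

Lemma causal_le_trans : transitive causal_le.
Proof.
move=> q p r pq qr; apply: le_trans (metric_triangle p.1 q.1 r.1) _.
by have := lerD pq qr; rewrite [leRHS]addrC subrKA.
Qed.

HB.instance Definition _ := Order.Le_isPOrder.Build ring_display event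
  causal_le_refl causal_le_anti causal_le_trans.

End event.

Section Cau.
Variables (R : realType) (ell : R) (X : metricType R).

Definition cau (a b : X) : set (event X) :=
  [set p | [/\ 0 <= p.2 <= ell, mdist a p.1 <= p.2 & mdist p.1 b <= ell - p.2]].

Definition Cau : Type := {ab : X * X & cau ab.1 ab.2}.

HB.instance Definition _ := Choice.copy Cau {ab : X * X & cau ab.1 ab.2}.

Definition cau_event (p : Cau) : event X := val (tagged p).

Definition Cau_le (p q : Cau) : bool :=
  (tag p == tag q) && (cau_event p <= cau_event q)%O.

Lemma Cau_le_refl : reflexive Cau_le.
Proof. by move=> p; rewrite /Cau_le eqxx lexx. Qed.

Lemma Cau_le_anti : antisymmetric Cau_le.
Proof.
move=> [ab p] [cd q] /andP[/andP[/= /eqP e pq] /andP[_ qp]].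
case: cd / e q pq qp => q pq qp; congr existT.
by apply/val_inj/le_anti; rewrite pq qp.
Qed.

Lemma Cau_le_trans : transitive Cau_le.
Proof.
move=> q p r /andP[/eqP pq lpq] /andP[/eqP qr lqr].
by rewrite /Cau_le pq qr eqxx (le_trans lpq lqr).
Qed.

HB.instance Definition _ := Order.Le_isPOrder.Build ring_display Cau
  Cau_le_refl Cau_le_anti Cau_le_trans.

End Cau.

Definition path_length (R : realType) (X : metricType R) (s : seq X) : R :=
  \sum_(p <- zip s (behead s)) mdist p.1 p.2.

Section magnitude.
Variables (R : realType) (ell : R).

Definition Cau_complex (X : metricType R) : set {fset Cau ell X} :=
  @order_complex _ (Cau ell X).

Definition short_complex (X : metricType R) : set {fset Cau ell X} :=
  [set s | Cau_complex s /\
    path_length [seq (cau_event p).1 | p <- sort <=%O s] < ell].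

Definition magnitude_type (X : metricType R) : ptopologicalType :=
  realization_quotient R (@Cau_complex X) (@short_complex X).

Variables (H : metricType R) (K : set H).

Definition interior_simplices : set {fset Cau ell H} :=
  [set s | Cau_complex s /\ exists2 p, p \in s & ~ K (cau_event p).1].

Definition interior_magnitude_type : ptopologicalType :=
  realization_quotient R (interior_simplices `|` @short_complex H)
    (@short_complex H).

End magnitude.

(* Main.v *)
Require Import Defs.
From mathcomp Require Import all_boot all_order all_algebra.
From mathcomp Require Import finmap lra.
From mathcomp Require Import all_classical all_reals all_analysis.
From mathcomp Require Import wedge_sigT.

(** A chain has length [ell] only if it runs from time [0] to time [ell] and all
    its steps are tight. If all its points lie in [K], its end points are
    therefore those of the causal diamond containing it, so that it comes from
    [Cau ell K]. A point [y] outside [K] that is comparable with all the points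
    of such a chain falls strictly inside it, between consecutive points [k] and
    [k']; projecting [y] to [p] gives [d(k, y) + d(y, k') >= d(k, k') + 2 d(p,
    y)], so that the step from [k] to [k'] is not tight: there is no such [y].
    Hence every face of a simplex with a point outside [K] has a point outside
    [K] or is short. The simplices of length [ell] thus fall into two families,
    those with and those without a point outside [K], each of which generates a
    subcomplex modulo the short simplices, and the two subcomplexes meet only in
    short simplices. *)

Set Implicit Arguments.
Unset Strict Implicit.
Unset Printing Implicit Defensive.

Import Order.TTheory GRing.Theory Num.Theory.
Local Open Scope classical_set_scope.
Local Open Scope ring_scope.

(** * Pointed quotients and the maps induced between them *)

Section collapse.
Variables (X : topologicalType) (A : set X).

Lemma collapse_None (x : X) : A x -> collapse A x = None.
Proof.
by move=> Ax; rewrite /collapse insubN //; apply/negP => /set_mem; apply.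
Qed.

Lemma collapse_Some (x : ~` A) : collapse A (val x) = Some x.
Proof. exact: valK. Qed.

Lemma collapse_inj (x y : X) : ~ A x -> collapse A x = collapse A y -> x = y.
Proof.
move=> nAx; rewrite /collapse; case: insubP => [u _ <-|]; last first.
  by move=> /negP; case; exact/mem_set.
by case: insubP => // v _ <- [->].
Qed.

Lemma collapse_eq_None (x : X) : collapse A x = None -> A x.
Proof.
move=> xN; apply: contrapT => nAx; move: xN.
by rewrite /collapse insubT //; exact/mem_set.
Qed.

Lemma open_quotient_byE (U : set (quotient_by A)) :
  open U = open (collapse A @^-1` U).
Proof. by []. Qed.

End collapse.

Section quotient_map.
Variables (X Y : topologicalType) (A : set X) (B : set Y) (h : X -> Y).

(** A class other than the base point has exactly one representative, so this makes sense for any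
    [h]; it is the map induced by [h] as soon as [h] carries [A] into [B]. *)
Definition quotient_map (o : quotient_by A) : quotient_by B :=
  if o is Some x then collapse B (h (val x)) else None.

Lemma quotient_map_collapse (x : X) : (forall x, A x -> B (h x)) ->
  quotient_map (collapse A x) = collapse B (h x).
Proof.
move=> AB; case: (pselect (A x)) => [Ax|nAx].
  by rewrite (collapse_None Ax) collapse_None//; exact: AB.
by rewrite -{1}[x](SubK (~` A) (mem_set nAx)) collapse_Some.
Qed.

Lemma quotient_map_continuous :
  (forall x, A x -> B (h x)) -> continuous h -> continuous quotient_map.
Proof.
move=> AB /continuousP ch; apply/continuousP => U oU.
rewrite open_quotient_byE (_ : _ @^-1` _ = h @^-1` (collapse B @^-1` U));
  first exact: ch.
by apply/seteqP; split=> x /=; rewrite quotient_map_collapse.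
Qed.

End quotient_map.

(** * Realizations and their pushforward along an injection of vertices *)

Section coords.
Variables (R : realType) (V : choiceType) (F : set {fset V}).

Lemma coords_inj : injective (@coords R V F).
Proof. exact: val_inj. Qed.

Lemma coordsP (x : realization R F) : [/\ F (finsupp (coords x)),
  forall v, 0 <= coords x v & \sum_(v <- finsupp (coords x)) coords x v = 1].
Proof. exact: (set_mem (valP x)). Qed.

Lemma open_realizationE (U : set (realization R F)) :
  open U = realization_open U.
Proof. by []. Qed.

End coords.

Section pushforward.
Variables (R : realType) (V W : choiceType) (j : V -> W).
Hypothesis j_inj : injective j.

(** The pushforward of a finitely supported weight; as [j] is injective, the sum over a fibre has a
    single term. *)
Definition fspush (f : {fsfun V -> R with 0}) : {fsfun W -> R with 0} :=
  [fsfun w in (j @` finsupp f)%fset => \sum_(v <- finsupp f | j v == w) f v].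

Lemma fspushE f v : fspush f (j v) = f v.
Proof.
rewrite fsfun_fun mem_imfset//=; case: finsuppP => // vf.
rewrite big_mkcond (bigD1_seq v)//= eqxx big1 ?addr0// => u uv.
by rewrite (inj_eq j_inj) (negbTE uv).
Qed.

Lemma finsupp_fspush f : finsupp (fspush f) = (j @` finsupp f)%fset.
Proof.
apply/fsetP => w; apply/idP/imfsetP => /= [|[v vf ->]].
  rewrite mem_finsupp fsfun_fun; case: ifPn; last by rewrite eqxx.
  by move=> /imfsetP[v /= vf ->] _; exists v.
by rewrite mem_finsupp fspushE -mem_finsupp.
Qed.

Variables (F : set {fset V}) (F' : set {fset W}).
Hypothesis jF : forall s, F s -> F' (j @` s)%fset.

Lemma fspush_realization (x : realization R F) :
  fspush (coords x) \in [set f : {fsfun W -> R with 0} |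
    [/\ F' (finsupp f), forall v, 0 <= f v & \sum_(v <- finsupp f) f v = 1]].
Proof.
have [Fx x0 x1] := coordsP x; apply/mem_set; split => [|w|].
- by rewrite finsupp_fspush; exact: jF.
- rewrite fsfun_fun; case: ifP => // _; exact: sumr_ge0.
- rewrite finsupp_fspush big_imfset/=; last by move=> ? ? _ _; exact: j_inj.
  by rewrite -[RHS]x1; apply: eq_bigr => v _; rewrite fspushE.
Qed.

Definition push (x : realization R F) : realization R F' :=
  exist _ (fspush (coords x)) (fspush_realization x).

Lemma coords_push x v : coords (push x) (j v) = coords x v.
Proof. exact: fspushE. Qed.

Lemma finsupp_push x :
  finsupp (coords (push x)) = (j @` finsupp (coords x))%fset.
Proof. exact: finsupp_fspush. Qed.

Lemma push_inj : injective push.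
Proof.
move=> x y xy; apply/coords_inj/fsfunP => v.
by rewrite -!coords_push xy.
Qed.

Lemma push_continuous : continuous push.
Proof.
apply/continuousP => U; rewrite !open_realizationE => oU s Fs x xs Ux.
(* The radius found on the image of [s] also serves on [s], since [push] keeps coordinates
   unchanged. *)
have [|e e0 eU] := oU _ (jF Fs) (push x) _ Ux.
  by rewrite finsupp_push; apply: subset_imfset; exact/fsubsetP.
exists e => // y ys xy; apply: eU.
  by rewrite finsupp_push; apply: subset_imfset; exact/fsubsetP.
by move=> w /imfsetP[v /= vs ->]; rewrite !coords_push; exact: xy.
Qed.

(** The preimage reads off the coordinates of [y] along [j]. Keeping it in the closed simplex [s] is
    what allows weak topologies to be compared simplex by simplex. *)
Lemma push_surj (s : {fset V}) (y : realization R F') :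
  (forall t, t != fset0 -> (t `<=` s)%fset -> F t) ->
  (finsupp (coords y) `<=` j @` s)%fset ->
  exists2 x : realization R F, (finsupp (coords x) `<=` s)%fset & y = push x.
Proof.
move=> Fs ys; have [_ y0 y1] := coordsP y.
pose f : {fsfun V -> R with 0} := [fsfun v in s => coords y (j v)].
have fE v : f v = coords y (j v).
  rewrite fsfun_fun; case: ifPn => // /negP vs; rewrite fsfun_dflt//.
  by apply/negP => /(fsubsetP ys); rewrite mem_imfset.
have fs : (finsupp f `<=` s)%fset.
  apply/fsubsetP => v.
  by rewrite mem_finsupp fsfun_fun; case: ifP; rewrite ?eqxx.
have pf : fspush f = coords y.
  apply/fsfunP => w; have [wy|wy] := boolP (w \in (j @` s)%fset).
    by have /imfsetP[v /= vs ->] := wy; rewrite fspushE fE.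
  rewrite !fsfun_dflt//; apply: contra wy; first exact: (fsubsetP ys).
  by rewrite finsupp_fspush; apply/fsubsetP/subset_imfset/fsubsetP.
have f1 : \sum_(v <- finsupp f) f v = 1.
  rewrite -y1 -pf finsupp_fspush big_imfset/=; last first.
    by move=> ? ? _ _; exact: j_inj.
  by apply: eq_bigr => v _; rewrite fspushE.
have Ff : f \in [set f : {fsfun V -> R with 0} |
    [/\ F (finsupp f), forall v, 0 <= f v & \sum_(v <- finsupp f) f v = 1]].
  apply/mem_set; split=> // [|v]; last by rewrite fE.
  (* The support is nonempty because the coordinates sum to 1. *)
  apply: Fs => //; apply/eqP => f0; move: f1; rewrite f0 big_seq_fset0.
  by move=> /esym/eqP; rewrite oner_eq0.
exists (exist _ f Ff) => //.
exact/val_inj/esym.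
Qed.

End pushforward.

(** * Splitting a relative realization as a wedge *)

Section wedge.
Variables (R : realType) (V W : choiceType) (j : V -> W).
Hypothesis j_inj : injective j.
(** [E] and the image of [F'] cover [F], and by [jE] and [jG] they overlap only inside [G], which is
    collapsed. *)
Variables (F E G : set {fset W}) (F' G' : set {fset V}).
Hypothesis GE : G `<=` E.
Hypothesis EF : E `<=` F.
Hypothesis E_face : forall s t, E s -> F t -> (t `<=` s)%fset -> E t.
Hypothesis F'_face : forall s t, F' s -> t != fset0 -> (t `<=` s)%fset -> F' t.
Hypothesis jF : forall s, F' s -> F (j @` s)%fset.
Hypothesis jG : forall s, G' s -> G (j @` s)%fset.
Hypothesis jE : forall s, F' s -> E (j @` s)%fset -> G' s.
Hypothesis F_cover : forall s, F s -> ~ E s ->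
  exists2 s', F' s' & s = (j @` s')%fset.

Let idF s : E s -> F (id @` s)%fset.
Proof. by rewrite imfset_id; exact: EF. Qed.

(** The inclusion of [E] is a pushforward along the identity, so that both summands obey the same
    lemmas. *)
Let pushE : realization R E -> realization R F := push (@inj_id W) idF.
Let pushK : realization R F' -> realization R F := push j_inj jF.

Let X := realization_quotient R E G.
Let Y := realization_quotient R F' G'.
Let Z := realization_quotient R F G.

Let part (b : bool) : (if b then X else Y) -> Z :=
  match b with
  | true => quotient_map _ pushE
  | false => quotient_map _ pushK
  end.

Let glue : wedge_sum X Y -> Z := wedge_fun part.

Let pushE_G (x : realization R E) :
  G (finsupp (coords x)) -> G (finsupp (coords (pushE x))).
Proof. by rewrite finsupp_push imfset_id. Qed.

Let pushK_G (x : realization R F') :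
  G' (finsupp (coords x)) -> G (finsupp (coords (pushK x))).
Proof. by rewrite finsupp_push; exact: jG. Qed.

Let part_point i k :
  part (point : if i then X else Y) = part (point : if k then X else Y).
Proof. by case: i; case: k. Qed.

Let lift (b : bool) (x : if b then X else Y) : wedge_sum X Y :=
  @wedge_lift bool (fun b : bool => if b then X else Y) (fun=> point) b x.

Let liftE (x : realization R E) : wedge_sum X Y :=
  lift (b := true) (collapse _ x).
Let liftK (x : realization R F') : wedge_sum X Y :=
  lift (b := false) (collapse _ x).

Let glue_liftE (x : realization R E) : glue (liftE x) = collapse _ (pushE x).
Proof.
rewrite /glue /liftE /lift wedge_lift_funE//=; exact: quotient_map_collapse.
Qed.

Let glue_liftK (x : realization R F') : glue (liftK x) = collapse _ (pushK x).
Proof.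
rewrite /glue /liftK /lift wedge_lift_funE//=; exact: quotient_map_collapse.
Qed.

Let glue_point : glue point = point.
Proof.
have -> : point = lift (b := false) point :> wedge_sum X Y by [].
by rewrite /glue /lift wedge_lift_funE.
Qed.

Let glue_continuous : continuous glue.
Proof.
apply: wedge_fun_continuous => // -[]; apply: quotient_map_continuous => //.
  exact: push_continuous.
exact: push_continuous.
Qed.

(** Away from the base point, elements are represented outside the collapsed part, where [collapse]
    is injective. *)
Let wedge_case (w : wedge_sum X Y) : [\/ w = point,
  exists2 x, ~ G (finsupp (coords x)) & w = liftE x |
  exists2 x, ~ G' (finsupp (coords x)) & w = liftK x].
Proof.
have : [set: wedge_sum X Y] w by [].
rewrite -wedgeTE => -[[] _ [[x|] _ <-]].
- by apply: Or32; exists (val x); [exact: (set_mem (valP x))|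
    rewrite /liftE collapse_Some].
- apply: Or31; exact: (@wedge_liftE bool (fun b => if b then X else Y)
    (fun=> point) false point true point).
- by apply: Or33; exists (val x); [exact: (set_mem (valP x))|
    rewrite /liftK collapse_Some].
- exact: Or31.
Qed.

Let collapseZ_neq (x : realization R F) :
  ~ G (finsupp (coords x)) -> (collapse _ x : Z) <> point.
Proof. by move=> nG /collapse_eq_None. Qed.

Let pushE_nG x : ~ G (finsupp (coords x)) -> ~ G (finsupp (coords (pushE x))).
Proof. by rewrite finsupp_push imfset_id. Qed.

Let pushK_nG x : ~ G' (finsupp (coords x)) -> ~ G (finsupp (coords (pushK x))).
Proof.
rewrite finsupp_push => nG' /GE; apply: contra_not nG' => /jE; apply.
by have [] := coordsP x.
Qed.

Let pushE_pushK x y : ~ G' (finsupp (coords y)) -> pushE x <> pushK y.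
Proof.
move=> nG' xy; apply: nG'; apply: jE; first by have [] := coordsP y.
rewrite -(finsupp_push j_inj jF) -[push _ _ _]/(pushK y) -xy finsupp_push.
by rewrite imfset_id; have [] := coordsP x.
Qed.

Let glue_inj : injective glue.
Proof.
move=> w1 w2.
have [->|[x nx ->]|[x nx ->]] := wedge_case w1;
  have [->|[y ny ->]|[y ny ->]] := wedge_case w2;
  rewrite ?glue_point ?glue_liftE ?glue_liftK //.
- by move=> /esym/collapseZ_neq; case; exact: pushE_nG.
- by move=> /esym/collapseZ_neq; case; exact: pushK_nG.
- by move=> /collapseZ_neq; case; exact: pushE_nG.
- by move=> /collapse_inj - /(_ (pushE_nG nx))/push_inj ->.
- by move=> /collapse_inj - /(_ (pushE_nG nx))/pushE_pushK; case.
- by move=> /collapseZ_neq; case; exact: pushK_nG.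
- by move=> /esym/collapse_inj - /(_ (pushE_nG ny))/pushE_pushK; case.
- by move=> /collapse_inj - /(_ (pushK_nG nx))/push_inj ->.
Qed.

Let pushE_surj (s : {fset W}) (y : realization R F) : E s ->
  (finsupp (coords y) `<=` s)%fset ->
  exists2 x, (finsupp (coords x) `<=` s)%fset & y = pushE x.
Proof.
move=> Es ys.
have Ey : E (finsupp (coords y)).
  by apply: E_face ys => //; have [] := coordsP y.
have yE : coords y \in [set f : {fsfun W -> R with 0} |
    [/\ E (finsupp f), forall v, 0 <= f v & \sum_(v <- finsupp f) f v = 1]].
  by apply/mem_set; have [_ ? ?] := coordsP y; split.
exists (exist _ (coords y) yE) => //.
apply/coords_inj/fsfunP => w.
by rewrite -[w in RHS]/(id w) coords_push.
Qed.

Let pushK_surj (s : {fset V}) (y : realization R F) : F' s ->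
  (finsupp (coords y) `<=` j @` s)%fset ->
  exists2 x, (finsupp (coords x) `<=` s)%fset & y = pushK x.
Proof. by move=> Fs; apply: push_surj => t t0 ts; exact: F'_face ts. Qed.

Let glue_surj z : exists w, glue w = z.
Proof.
case: z => [[y ny]|]; last by exists point; exact: glue_point.
have -> : Some (exist _ y ny) = collapse _ y :> Z by rewrite -collapse_Some.
have [Fy _ _] := coordsP y.
have [Ey|nEy] := pselect (E (finsupp (coords y))).
  by have [x _ ->] := pushE_surj Ey (fsubset_refl _); exists (liftE x).
have [s Fs ys] := F_cover Fy nEy.
have [|x _ ->] := @pushK_surj s y Fs; first by rewrite ys.
by exists (liftK x).
Qed.

(** The map [glue] is a continuous bijection. Its inverse is continuous because openness in the weak
    topology is tested on one simplex at a time, and each simplex belongs to [E] or is the image of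
    one of [F']. *)
Lemma realization_quotient_wedge :
  pointed_homeomorphic (realization_quotient R F G)
    (wedge_sum (realization_quotient R E G) (realization_quotient R F' G')).
Proof.
have /choice[f fK] := glue_surj.
have gK : cancel glue f by move=> w; apply: glue_inj; rewrite fK.
exists f, glue; split => //; last by rewrite -[X in f X]glue_point gK.
apply/continuousP => U /wedge_openP oU.
rewrite open_quotient_byE open_realizationE => s Fs y ys /= Uy.
have [Es|nEs] := pselect (E s).
  have := oU true; rewrite open_quotient_byE open_realizationE.
  move: Uy; have [x xs ->] := pushE_surj Es ys.
  (* On points of the form [pushE x] the inverse is [liftE], so the question moves to the summand
     [X]. *)
  rewrite -glue_liftE gK => Ux /(_ s Es x xs Ux)[e e0 eU].
  exists e => // y' y's; have [x' x's ->] := pushE_surj Es y's.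
  move=> xx'; rewrite -glue_liftE gK; apply: eU => // v vs.
  by have := xx' v vs; rewrite -[v in coords (pushE _) v]/(id v) !coords_push.
have [s' F's sE] := F_cover Fs nEs.
rewrite sE in ys *.
have := oU false; rewrite open_quotient_byE open_realizationE.
move: Uy; have [x xs ->] := pushK_surj F's ys.
rewrite -glue_liftK gK => Ux /(_ s' F's x xs Ux)[e e0 eU].
exists e => // y' y's; have [x' x's ->] := pushK_surj F's y's.
move=> xx'; rewrite -glue_liftK gK; apply: eU => // v vs.
have := xx' (j v); rewrite !coords_push; apply.
by rewrite mem_imfset.
Qed.

End wedge.

(** * Lengths of paths and of causal chains *)

Section path_length.
Variables (R : realType) (X : metricType R).
Implicit Types (x y : X) (s t : seq X) (p q : event X) (c : seq (event X)).

Lemma path_length0 : @path_length R X [::] = 0.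
Proof. by rewrite /path_length big_nil. Qed.

Lemma path_length1 x : path_length [:: x] = 0.
Proof. by rewrite /path_length big_nil. Qed.

Lemma path_length_cons x y s :
  path_length (x :: y :: s) = mdist x y + path_length (y :: s).
Proof. by rewrite /path_length /= big_cons. Qed.

Lemma path_length_ge0 s : 0 <= path_length s.
Proof. by apply: sumr_ge0 => p _; exact: mdist_ge0. Qed.

(** Removing [y] affects only the steps around it, where the triangle inequality applies. *)
Lemma path_length_shift x y s :
  path_length (x :: s) <= mdist x y + path_length (y :: s).
Proof.
case: s => [|z s]; first by rewrite !path_length1 addr0 mdist_ge0.
rewrite !path_length_cons addrA lerD2r; exact: metric_triangle.
Qed.

Lemma subseq_path_length s t : subseq s t -> path_length s <= path_length t.
Proof.
(* With a common head [x], every removed point comes after some other point, so [path_length_shift]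
   handles it. *)
have main x : forall s t, subseq s t ->
    path_length (x :: s) <= path_length (x :: t).
  move=> {}s {}t; elim: t x s => [|y t IH] x [|z s]//=.
  - move=> _; rewrite path_length1; exact: path_length_ge0.
  - case: eqP => [->|_] st; rewrite !path_length_cons.
      by rewrite lerD2l; exact: IH.
    rewrite -path_length_cons; apply: le_trans (path_length_shift _ y _) _.
    by rewrite lerD2l; exact: IH.
elim: t s => [|y t IH] [|z s]//= st.
  by rewrite path_length0 path_length_ge0.
move: st; case: eqP => [->|_]; first exact: main.
move=> /IH/le_trans; apply; case: t {IH} => [|u t].
  by rewrite path_length1 path_length0.
by rewrite path_length_cons lerDr mdist_ge0.
Qed.

Lemma causal_leE p q : (p <= q) = (mdist p.1 q.1 <= q.2 - p.2).
Proof. by []. Qed.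

Lemma causal_path_length p c : path <=%O p c ->
  path_length [seq r.1 | r <- p :: c] <= (last p c).2 - p.2.
Proof.
elim: c p => [|q c IH] p /=; first by rewrite path_length1 subrr.
move=> /andP[pq /IH]; rewrite path_length_cons; move: pq; rewrite causal_leE.
move=> /= ? ?; lra.
Qed.

(** The event [q] falls in a gap of the chain, and the strict triangle inequality makes the step
    across that gap shorter than the time it takes. The induction walks along the chain to this
    gap. *)
Lemma causal_path_length_lt p c q : path <=%O p c ->
  {in p :: c &, forall r r', mdist r.1 r'.1 < mdist r.1 q.1 + mdist q.1 r'.1} ->
  {in p :: c, forall r, (r <= q) || (q <= r)} ->
  p <= q -> q <= last p c ->
  path_length [seq r.1 | r <- p :: c] < (last p c).2 - p.2.
Proof.
elim: c p => [|p' c IH] p /= + away comp.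
  (* On a one-event chain [q] equals [p], and the strict inequality reads [0 < 0]. *)
  move=> _ pq qp; have := away p p; rewrite !inE eqxx => /(_ isT isT).
  have -> : p = q by apply/le_anti; rewrite pq.
  by rewrite !mdistxx addr0 ltxx.
move=> /andP[pp' cc] pq ql; rewrite path_length_cons.
have /orP[p'q|qp'] := comp p' ltac:(by rewrite !inE eqxx orbT).
  have IHp' : path_length [seq r.1 | r <- p' :: c] < (last p' c).2 - p'.2.
    apply: IH => //.
      by move=> r r' rc r'c; apply: away; rewrite inE ?rc ?r'c orbT.
    by move=> r rc; apply: comp; rewrite inE rc orbT.
  move: pp' IHp'; rewrite causal_leE /=; lra.
have := away p p'; rewrite !inE !eqxx orbT => /(_ isT isT).
have := causal_path_length cc.
move: pq qp'; rewrite !causal_leE /=; lra.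
Qed.

End path_length.

(** * Finite chains in posets and their sorted lists *)

Lemma fset_imfset_surj (V W : choiceType) (j : V -> W) (s : {fset W}) :
  {in s, forall w, exists v, j v = w} ->
  exists s' : {fset V}, s = (j @` s')%fset.
Proof.
move=> js; have /choice[r rE] : forall w : s, exists v, j v = val w.
  by move=> w; exact: js (valP w).
exists [fset v in [seq r w | w <- enum {: s}]]%fset.
apply/fsetP => w; apply/idP/imfsetP => /= [ws|[v]].
  exists (r [` ws]%fset); last by rewrite rE.
  by rewrite inE map_f// mem_enum.
by rewrite inE => /mapP[u _ ->] ->; rewrite rE; exact: valP.
Qed.

Section order_complex.
Context d (P : porderType d).
Implicit Types s t : {fset P}.

Lemma order_complex_face s t :
  order_complex s -> t != fset0 -> (t `<=` s)%fset -> order_complex t.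
Proof.
move=> [_ sP] t0 /fsubsetP ts; split=> // p q /ts ps /ts qs; exact: sP.
Qed.

Lemma order_complex_sort s : order_complex s ->
  exists p c, sort <=%O s = p :: c /\ path <=%O p c.
Proof.
move=> [s0 sP]; have := @sort_sorted_in _ (mem s) <=%O sP s.
have : size (sort <=%O s) != 0%N by rewrite size_sort cardfs_eq0.
case: (sort <=%O s) => // p c _ /(_ _)pc; exists p, c; split=> //.
by apply: pc; exact/allP.
Qed.

(** The sorted list of a chain depends only on its elements, so [t] may be enumerated as a sublist
    of [s], and sorting preserves sublists. *)
Lemma subseq_sort_face s t : order_complex s -> (t `<=` s)%fset ->
  subseq (sort <=%O t) (sort <=%O s).
Proof.
move=> [_ sP] /fsubsetP ts.
have -> : sort <=%O t = sort <=%O [seq p <- s | p \in t].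
  apply/perm_sort_inP.
  - by move=> p q /ts ps /ts qs; exact: sP.
  - by move=> ? ? ? _ _ _; exact: le_trans.
  - by move=> ? ? _ _; exact: le_anti.
  - apply: uniq_perm; rewrite ?filter_uniq ?fset_uniq// => p.
    by rewrite mem_filter; case: (boolP (p \in t)) => // /ts ->.
apply: (@subseq_sort_in _ <=%O) => //; last exact: filter_subseq.
by move=> ? ? ? _ _ _; exact: le_trans.
Qed.

End order_complex.

Lemma order_complex_image d d' (P : porderType d) (Q : porderType d')
  (j : P -> Q) (s : {fset P}) : {mono j : p q / (p <= q)%O} ->
  order_complex (j @` s)%fset <-> order_complex s.
Proof.
move=> jm; split=> -[s0 sP]; split.
- by apply: contra_neq s0 => ->; rewrite imfset0.
- move=> p q ps qs; have := sP (j p) (j q).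
  by rewrite /Order.comparable !jm; apply; apply/imfsetP; [exists p|exists q].
- have [p ps] := fset0Pn _ s0.
  by apply/fset0Pn; exists (j p); apply/imfsetP; exists p.
- move=> _ _ /imfsetP[p /= ps ->] /imfsetP[q /= qs ->].
  by rewrite /Order.comparable !jm; exact: sP.
Qed.

Lemma sort_imfset d d' (P : porderType d) (Q : porderType d')
  (j : P -> Q) (s : {fset P}) : {mono j : p q / (p <= q)%O} ->
  order_complex s ->
  sort <=%O (j @` s)%fset = [seq j p | p <- sort <=%O s].
Proof.
move=> jm sP; have [_ jsP] := (order_complex_image s jm).2 sP.
transitivity (sort <=%O [seq j p | p <- s]).
  apply/perm_sort_inP => //.
  - by move=> ? ? ? _ _ _; exact: le_trans.
  - by move=> ? ? _ _; exact: le_anti.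
  - apply: uniq_perm; first exact: fset_uniq.
      by rewrite map_inj_uniq ?fset_uniq//; exact: inc_inj.
    move=> q; apply/imfsetP/mapP => /= -[p ps ->]; by exists p.
by apply/esym/map_sort => p q; rewrite jm.
Qed.

(** * Chains in the causal diamonds *)

Section chains.
Variables (R : realType) (ell : R) (X : metricType R).
Implicit Types (p q : Cau ell X) (s t : {fset Cau ell X}).

Definition points s : seq X := [seq (cau_event p).1 | p <- sort <=%O s].

Lemma cau_eventP p : [/\ 0 <= (cau_event p).2 <= ell,
  mdist (tag p).1 (cau_event p).1 <= (cau_event p).2 &
  mdist (cau_event p).1 (tag p).2 <= ell - (cau_event p).2].
Proof. exact: (set_mem (valP (tagged p))). Qed.

Lemma Cau_leE p q : (p <= q) = (tag p == tag q) && (cau_event p <= cau_event q).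
Proof. by []. Qed.

(** Antisymmetry of the order replaces a transport of the event along the equality of tags. *)
Lemma Cau_eq p q : tag p = tag q -> cau_event p = cau_event q -> p = q.
Proof. by move=> pq e; apply/le_anti; rewrite !Cau_leE pq e eqxx lexx. Qed.

Lemma points_chain s : Cau_complex s -> exists p c,
  [/\ sort <=%O s = p :: c, path <=%O (cau_event p) [seq cau_event q | q <- c] &
   points s = [seq r.1 | r <- cau_event p :: [seq cau_event q | q <- c]]].
Proof.
move=> /order_complex_sort[p [c [e pc]]]; exists p, c; split=> //.
  rewrite path_map; apply: sub_path pc => q r; by rewrite Cau_leE => /andP[].
by rewrite /points e /= -map_comp.
Qed.

Lemma short_face s t : short_complex s -> Cau_complex t -> (t `<=` s)%fset ->
  short_complex t.
Proof.
move=> [sP sl] tP ts; split=> //; apply: le_lt_trans sl.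
by apply/subseq_path_length/map_subseq/subseq_sort_face.
Qed.

(** The length is at most the elapsed time, itself at most [ell]. Equality puts the first vertex at
    time 0 and the last at time [ell], where the diamond leaves only its own end points. *)
Lemma long_chain s : Cau_complex s -> ~ short_complex s ->
  exists p q, [/\ p \in s, q \in s, (tag p).1 = (cau_event p).1 &
                  (tag q).2 = (cau_event q).1].
Proof.
move=> sP ns; have ls : ell <= path_length (points s).
  by rewrite leNgt; apply/negP => ?; apply: ns.
have [p [c [e pc pE]]] := points_chain sP.
move: ls; rewrite pE => /le_trans /(_ (causal_path_length pc)).
rewrite last_map.
have ps : p \in s by rewrite -(mem_sort <=%O) e mem_head.
have qs : last p c \in s by rewrite -(mem_sort <=%O) e mem_last.
have [/andP[p0 p1] p2 p3] := cau_eventP p.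
have [/andP[q0 q1] q2 q3] := cau_eventP (last p c) => ls.
exists p, (last p c); split=> //.
  by apply: mdist_positivity; have := mdist_ge0 (tag p).1 (cau_event p).1; lra.
apply/esym/mdist_positivity.
have := mdist_ge0 (cau_event (last p c)).1 (tag (last p c)).2; lra.
Qed.

Lemma chain_tag s p q : Cau_complex s -> p \in s -> q \in s -> tag p = tag q.
Proof.
move=> [_ sP] ps qs; have := sP p q ps qs; rewrite /Order.comparable !Cau_leE.
by move=> /orP[] /andP[/eqP].
Qed.

End chains.

(** * Chains of full length and points outside [K] *)

Section projection.
Variables (R : realType) (ell : R) (H : metricType R) (K : set H).
Hypothesis K_proj : forall y, ~ K y -> projects_to K y.

(** By projection the right side is [d(x, p) + d(p, z) + 2 d(p, y)], and [p] differs from [y]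
    because it lies in [K]. *)
Lemma projects_to_mdist_lt (x y z : H) : K x -> K z -> ~ K y ->
  mdist x z < mdist x y + mdist y z.
Proof.
move=> Kx Kz nKy; have [p Kp pE] := K_proj nKy.
rewrite (metric_sym y z) (pE x Kx) (pE z Kz).
have py : 0 < mdist p y.
  rewrite lt_def mdist_ge0 andbT; apply/eqP => /mdist_positivity py.
  by apply: nKy; rewrite -py.
have := metric_triangle x p z; rewrite (metric_sym p z); lra.
Qed.

(** This makes the interior simplices, taken together with the short ones, closed under faces. *)
Lemma interior_face (s t : {fset Cau ell H}) : interior_simplices K s ->
  Cau_complex t -> (t `<=` s)%fset -> interior_simplices K t \/ short_complex t.
Proof.
move=> [sP [q qs nKq]] tP /fsubsetP ts.
have [Kt|nt] := pselect (forall r, r \in t -> K (cau_event r).1); last first.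
  left; split=> //; apply: contrapT => nr; apply: nt => r rt.
  by apply: contrapT => nK; apply: nr; exists r.
right; apply: contrapT => nshort; have ls : ell <= path_length (points t).
  by rewrite leNgt; apply/negP => ?; apply: nshort.
have [p [c [e pc pE]]] := points_chain tP.
have tE r : (r \in t) = (r \in p :: c) by rewrite -(mem_sort <=%O) e.
have ps : p \in t by rewrite tE mem_head.
have ls' : last p c \in t by rewrite tE mem_last.
have [/andP[p0 p1] _ _] := cau_eventP p.
have [/andP[l0 l1] _ _] := cau_eventP (last p c).
have [/andP[q0 q1] _ _] := cau_eventP q.
(* As times lie between 0 and [ell], the face starts at time 0 and stops at time [ell]. *)
have l : ell <= (cau_event (last p c)).2 - (cau_event p).2.
  by apply: le_trans ls _; rewrite pE -last_map causal_path_length.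
have comp r : r \in t ->
    (cau_event r <= cau_event q) || (cau_event q <= cau_event r).
  move=> /ts rs; have := sP.2 r q rs qs; rewrite /Order.comparable !Cau_leE.
  by move=> /orP[] /andP[_ ->]; rewrite ?orbT.
have ne r : r \in t -> 0 < mdist (cau_event r).1 (cau_event q).1.
  move=> rt; rewrite lt_def mdist_ge0 andbT; apply/eqP => /mdist_positivity rq.
  by apply: nKq; rewrite -rq; exact: Kt.
(* The opposite order would put [q] before time 0 here, and after time [ell] for the last vertex,
   since [q] is at positive distance from both. *)
have pq : cau_event p <= cau_event q.
  have /orP[//|] := comp p ps; have := ne p ps.
  rewrite causal_leE metric_sym => ? ?; exfalso; lra.
have ql : cau_event q <= cau_event (last p c).
  have /orP[|//] := comp _ ls'; have := ne _ ls'.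
  move: pq => _; rewrite causal_leE => ? ?; exfalso; lra.
have := @causal_path_length_lt _ _ _ _ (cau_event q) pc.
rewrite last_map -pE; move=> /(_ _ _ pq ql) lt.
suff : path_length (points t) < (cau_event (last p c)).2 - (cau_event p).2.
  by move: ls p0 l1; clear; lra.
apply: lt; rewrite -[_ :: _]/[seq cau_event q | q <- p :: c].
  move=> _ _ /mapP[r + ->] /mapP[r' + ->]; rewrite -!tE => rt r't.
  by apply: projects_to_mdist_lt => //; exact: Kt.
by move=> _ /mapP[r + ->]; rewrite -tE; exact: comp.
Qed.

End projection.

(** * The inclusion of the diamonds of [K] into those of [H] *)

Section Cau_incl.
Variables (R : realType) (ell : R) (H : metricType R) (K : set H).

Lemma cau_incl (a b : K) (p : event K) : cau ell a b p ->
  (val p.1, p.2) \in cau ell (val a) (val b).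
Proof. by move=> p_cau; exact/mem_set. Qed.

Definition Cau_incl (p : Cau ell K) : Cau ell H :=
  existT (fun ab : H * H => cau ell ab.1 ab.2) (val (tag p).1, val (tag p).2)
    (exist _ (val (cau_event p).1, (cau_event p).2) (cau_incl (cau_eventP p))).

Lemma Cau_incl_mono : {mono Cau_incl : p q / p <= q}.
Proof.
by move=> p q; rewrite !Cau_leE; congr (_ && _).
Qed.

Lemma path_length_val (s : seq K) :
  path_length (map val s : seq H) = path_length s.
Proof.
elim: s => [|x [|y s] IH]; rewrite ?path_length0 ?path_length1//=.
by rewrite !path_length_cons -IH.
Qed.

(** The inclusion reflects the order and preserves distances, so sorted lists and lengths
    correspond. *)
Lemma Cau_incl_short (s : {fset Cau ell K}) : Cau_complex s ->
  short_complex (Cau_incl @` s)%fset <-> short_complex s.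
Proof.
move=> sP; rewrite /short_complex /= (sort_imfset Cau_incl_mono)// -map_comp.
rewrite -path_length_val -map_comp /Cau_complex.
have := order_complex_image s Cau_incl_mono; tauto.
Qed.

Lemma Cau_incl_cover (s : {fset Cau ell H}) : Cau_complex s ->
  ~ (interior_simplices K `|` @short_complex R ell H) s ->
  exists2 s', Cau_complex s' & s = (Cau_incl @` s')%fset.
Proof.
move=> sP nE.
have Ks r : r \in s -> K (cau_event r).1.
  by move=> rs; apply: contrapT => nK; apply: nE; left; split=> //; exists r.
have [p [q [ps qs pE qE]]] : exists p q, [/\ p \in s, q \in s,
    (tag p).1 = (cau_event p).1 & (tag q).2 = (cau_event q).1].
  by apply: long_chain => // ?; apply: nE; right.
have [|s' sE] := @fset_imfset_surj _ _ Cau_incl s.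
  move=> r rs.
  (* All vertices share one pair of end points; the first is attained at [p] and the second at [q],
     so both lie in [K]. *)
  have Ka : K (tag r).1 by rewrite (chain_tag sP rs ps) pE; exact: Ks.
  have Kb : K (tag r).2 by rewrite (chain_tag sP rs qs) qE; exact: Ks.
  pose a : K := exist (fun x => x \in K) _ (mem_set Ka).
  pose b : K := exist (fun x => x \in K) _ (mem_set Kb).
  pose x : K := exist (fun x => x \in K) _ (mem_set (Ks _ rs)).
  have xP : (x, (cau_event r).2) \in cau ell a b.
    by apply/mem_set; exact: (cau_eventP r).
  exists (existT (fun ab : K * K => cau ell ab.1 ab.2) (a, b)
    (exist (fun e => e \in cau ell a b) _ xP)).
  by apply: Cau_eq; [rewrite [RHS]surjective_pairing|
    rewrite [RHS]surjective_pairing].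
exists s' => //; apply/(order_complex_image s' Cau_incl_mono).
by rewrite -sE.
Qed.

End Cau_incl.

Theorem proposition5p13 (R : realType) (H : metricType R) (K : set H)
    (K_compact : compact K)
    (K_proj : forall y : H, ~ K y -> projects_to K y)
    (ell : R) (ell_ge0 : 0 <= ell) :
  pointed_homeomorphic (magnitude_type ell H)
    (wedge_sum (interior_magnitude_type ell K) (magnitude_type ell K)).
Proof.
(* [F] and [F'] are the order complexes for [H] and [K], [G] and [G'] their short simplices, and [E]
   joins the interior simplices to [G]. *)
apply: (@realization_quotient_wedge _ _ _ (@Cau_incl _ ell _ K)).
- exact: inc_inj (@Cau_incl_mono _ _ _ _).
- by move=> s; right.
- by move=> s [] [].
- move=> s t [sI|sS] tP ts; first exact: interior_face ts.
  by right; exact: short_face ts.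
- by move=> s t; exact: order_complex_face.
- by move=> s /(order_complex_image s (@Cau_incl_mono _ _ _ K)).
- by move=> s sS; apply/Cau_incl_short => //; case: sS.
(* An image simplex has all its vertices in [K], so it can belong to [E] only by being short. *)
- move=> s sP [[_ [_ /imfsetP[p /= _ ->]]]|/Cau_incl_short]; last exact.
  by case; exact: (set_mem (valP (cau_event p).1)).
- exact: Cau_incl_cover.
Qed.
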